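(* Let $p\in[0,1]$, $q=1-p$, let $(x_j)_{j\ge1}$ be independent and identically distributed $\mathrm{Bern}(p)$ random variables, and let $\mathcal T_n^{\mathrm B}=\mathcal T_n^{\mathrm B}(x_1,\ldots,x_n)$ be the associated simple butterfly tree. Then $$\frac1n\operatorname{HS}(\mathcal T_n^{\mathrm B})\longrightarrow \mu_p=\frac{pq}{1-pq}\quad\text{almost surely as } n\to\infty.$$
   Context: A rooted binary tree is a finite nonempty rooted tree in which each node has at most one left child and at most one right child. The Horton--Strahler (HS) number of a node $v$ is: $0$ if $v$ has no children; the HS number of the child if $v$ has exactly one child; and $\max(\operatorname{HS}(v_\ell),\operatorname{HS}(v_r))+\mathbf 1_{\{\operatorname{HS}(v_\ell)=\operatorname{HS}(v_r)\}}$ if $v$ has children $v_\ell,v_r$. $\operatorname{HS}(\mathcal T)$ is the HS number of the root of $\mathcal T$. $\mathcal T_1\oplus\mathcal T_2$ is obtained by making the root of $\mathcal T_2$ the right child of the last node of the path from the root of $\mathcal T_1$ that always moves to the right child; $\mathcal T_1\ominus\mathcal T_2$ is obtained by making the root of $\mathcal T_2$ the left child of the last node of the path from the root of $\mathcal T_1$ that always moves to the left child. Simple butterfly trees: for a bitstring $\mathbf x=(x_1,\ldots,x_n)\in\{0,1\}^n$, the simple butterfly tree $\mathcal T_n^{\mathrm B}(\mathbf x)$, with $2^n$ nodes, is defined recursively: $\mathcal T_0^{\mathrm B}$ (empty string) is a single node, and with $\mathcal S=\mathcal T_{n-1}^{\mathrm B}(x_1,\ldots,x_{n-1})$, $\mathcal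 T_n^{\mathrm B}(\mathbf x)$ is $\mathcal S\oplus\mathcal S$ if $x_n=0$ and $\mathcal S\ominus\mathcal S$ if $x_n=1$ (two identical copies of $\mathcal S$). *)

(* Defs.v *)
From HB Require Import structures.
From mathcomp Require Import all_boot all_order all_algebra finmap.
From mathcomp Require Import all_classical all_reals all_analysis.

Set Implicit Arguments.
Unset Strict Implicit.
Unset Printing Implicit Defensive.

Import Order.TTheory GRing.Theory Num.Theory.
Import numFieldNormedType.Exports.

Local Open Scope classical_set_scope.
Local Open Scope ring_scope.

Inductive btree := Node of option btree & option btree.

Definition single_node : btree := Node None None.

Fixpoint HS (t : btree) : nat :=
  match t with
  | Node None None => 0%N
  | Node (Some c) None | Node None (Some c) => HS c
  | Node (Some l) (Some r) => (maxn (HS l) (HS r) + (HS l == HS r))%N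
  end.

Fixpoint oplus (t1 t2 : btree) : btree :=
  let: Node l r := t1 in
  Node l (Some (if r is Some r' then oplus r' t2 else t2)).

Fixpoint ominus (t1 t2 : btree) : btree :=
  let: Node l r := t1 in
  Node (Some (if l is Some l' then ominus l' t2 else t2)) r.

(* The left fold consumes x_1 first, so that
   butterfly (rcons x b) = butterfly x (+) butterfly x   if b = 0 (false),
                           butterfly x (-) butterfly x   if b = 1 (true). *)
Definition butterfly (x : seq bool) : btree :=
  foldl (fun S (b : bool) => if b then ominus S S else oplus S S)
    single_node x.

Definition mutually_independent d d' (T : measurableType d)
    (T' : measurableType d') (R : realType) (P : probability T R)
    (I : choiceType) (X : I -> {RV P >-> T'}) : Prop :=
  forall (J : {fset I}) (A : I -> set T'),
    (forall i, i \in J -> measurable (A i)) ->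
    P (\bigcap_(i in [set` J]) X i @^-1` A i) =
    (\prod_(i <- J) P (X i @^-1` A i))%E.

(* A sequence (x_j)_{j >= 1} is indexed from 0: the variable x j is x_{j+1}. *)
Definition iid_bernoulli d (T : measurableType d) (R : realType)
    (P : probability T R) (p : R) (x : nat -> {RV P >-> bool}) : Prop :=
  mutually_independent x /\
  forall j (B : set bool), distribution P (x j) B = bernoulli_prob p B.

(* Main.v *)
(* Read the bits from left to right and cut the string greedily into blocks
   b^j (1-b) with j >= 1. The HS number of the simple butterfly tree is the number
   of completed blocks: along with HS one controls how the two spines of the tree
   act on the HS number of a subtree attached at their ends, and this action
   depends only on the letter of the current unfinished block.
   The number of completed blocks is an additive functional of a three-state
   Markov chain. Solving the Poisson equation gives a martingale M_n with
   increments bounded by 2, so that E[M_n^4] <= 64 n^2; hence the series of the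
   (M_n / n)^4 has finite expectation and M_n / n tends to 0 almost surely. *)
Require Import Defs.
From HB Require Import structures.
From mathcomp Require Import all_boot all_order all_algebra finmap.
From mathcomp Require Import all_classical all_reals all_analysis.
From mathcomp Require Import measurable_realfun zify ring lra.

Set Implicit Arguments.
Unset Strict Implicit.
Unset Printing Implicit Defensive.

Import Order.TTheory GRing.Theory Num.Theory.
Import numFieldNormedType.Exports.

(** * HS numbers of trees grafted at the end of a spine *)

Definition merge_above (c : option btree) (h : nat) : nat :=
  if c is Some t then (maxn (HS t) h + (HS t == h))%N else h.

(** All that [oplus t u] needs to know of [t]: the map from the HS number of [u] to that of the
    grafted tree. [lspine] is its mirror image for [ominus]. *)
Fixpoint rspine (t : btree) (h : nat) : nat :=
  let: Node l r := t in
  merge_above l (if r is Some r' then rspine r' h else h).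

Fixpoint lspine (t : btree) (h : nat) : nat :=
  let: Node l r := t in
  merge_above r (if l is Some l' then lspine l' h else h).

Definition orspine (c : option btree) (h : nat) : nat :=
  if c is Some t then rspine t h else h.

Definition olspine (c : option btree) (h : nat) : nat :=
  if c is Some t then lspine t h else h.

Definition ooplus (c : option btree) (u : btree) : btree :=
  if c is Some t then oplus t u else u.

Definition oominus (c : option btree) (u : btree) : btree :=
  if c is Some t then ominus t u else u.

Lemma HS_Node_r (l : option btree) (r : btree) :
  HS (Node l (Some r)) = merge_above l (HS r).
Proof. by case: l. Qed.

Lemma HS_Node_l (l : btree) (r : option btree) :
  HS (Node (Some l) r) = merge_above r (HS l).
Proof. by case: r => //= r; rewrite maxnC eq_sym. Qed.

Fixpoint HS_oplus (t u : btree) : HS (oplus t u) = rspine t (HS u).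
Proof.
by case: t => l [r|]; rewrite [oplus _ _]/= HS_Node_r //= HS_oplus.
Qed.

Fixpoint HS_ominus (t u : btree) : HS (ominus t u) = lspine t (HS u).
Proof.
by case: t => [[l|] r]; rewrite [ominus _ _]/= HS_Node_l //= HS_ominus.
Qed.

(** The right spine of [oplus t u] is that of [t] followed by that of [u], so the two actions
    compose. *)
Fixpoint rspine_oplus (t u : btree) (h : nat) :
  rspine (oplus t u) h = rspine t (rspine u h).
Proof. by case: t => l [r|] //=; rewrite rspine_oplus. Qed.

Fixpoint lspine_ominus (t u : btree) (h : nat) :
  lspine (ominus t u) h = lspine t (lspine u h).
Proof. by case: t => [[l|] r] //=; rewrite lspine_ominus. Qed.

Lemma HS_ooplus (c : option btree) (u : btree) :
  HS (ooplus c u) = orspine c (HS u).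
Proof. by case: c => //= t; rewrite HS_oplus. Qed.

Lemma HS_oominus (c : option btree) (u : btree) :
  HS (oominus c u) = olspine c (HS u).
Proof. by case: c => //= t; rewrite HS_ominus. Qed.

Lemma rspine_ooplus (c : option btree) (u : btree) (h : nat) :
  rspine (ooplus c u) h = orspine c (rspine u h).
Proof. by case: c => //= t; rewrite rspine_oplus. Qed.

Lemma lspine_oominus (c : option btree) (u : btree) (h : nat) :
  lspine (oominus c u) h = olspine c (lspine u h).
Proof. by case: c => //= t; rewrite lspine_ominus. Qed.

(* An absent child counts as having an HS number below everything. *)
Definition HS_lt (c : option btree) (k : nat) : bool :=
  if c is Some t then (HS t < k)%N else true.

Definition HS_is (c : option btree) (k : nat) : bool :=
  if c is Some t then HS t == k else false.

Lemma merge_above_lt (c : option btree) (k h : nat) :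
  HS_lt c k -> (k <= h)%N -> merge_above c h = h.
Proof. by case: c => //= t; lia. Qed.

Lemma merge_above_is (c : option btree) (k : nat) :
  HS_is c k -> merge_above c k = k.+1.
Proof. by case: c => //= t; lia. Qed.

Lemma HS_is_lt (c : option btree) (k : nat) : HS_is c k -> HS_lt c k.+1.
Proof. by case: c => //= t; lia. Qed.

(** * The HS number as a count of blocks *)

(* A state holds the number of completed blocks b^j (1-b), j >= 1, and the
   letter b of the current unfinished block, if any. *)
Definition block_step (a : nat * option bool) (b : bool) : nat * option bool :=
  match a.2 with
  | None => (a.1, Some b)
  | Some c => if c == b then a else (a.1.+1, None)
  end.

Definition blocks (s : seq bool) : nat * option bool :=
  foldl block_step (0%N, None) s.

(** The HS number alone is not inductive. The spines are those of the children, so the root is left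
    out: a grafted copy of HS number [a.1] reaches the root unchanged, and only the child on the
    other side decides whether the number grows. The last clause records which child, if any,
    already attains [a.1]. *)
Definition block_invariant (a : nat * option bool) (t : btree) : Prop :=
  let: Node l r := t in
  [/\ HS t = a.1,
      forall h, (a.1 <= h)%N -> olspine l h = h,
      forall h, (a.1 <= h)%N -> orspine r h = h &
      match a.2 with
      | None => HS_lt l a.1 && HS_lt r a.1
      | Some false => HS_lt l a.1 && HS_is r a.1
      | Some true => HS_is l a.1 && HS_lt r a.1
      end].

Lemma oplusE (l r : option btree) (u : btree) :
  oplus (Node l r) u = Node l (Some (ooplus r u)).
Proof. by case: r. Qed.

Lemma ominusE (l r : option btree) (u : btree) :
  ominus (Node l r) u = Node (Some (oominus l u)) r.
Proof. by case: l. Qed.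

Lemma block_invariant_oplus (a : nat * option bool) (t : btree) :
  block_invariant a t -> block_invariant (block_step a false) (oplus t t).
Proof.
case: t a => l r [k o] [HSt lk rk ab]; rewrite /= in lk rk ab.
have {}HSt : HS (Node l r) = k := HSt.
have HSr : HS (ooplus r (Node l r)) = k by rewrite HS_ooplus HSt rk.
(* The new spine runs through the old one twice, with the root of the second copy in between; a left
   child below [k] makes that root act trivially too. *)
have spineK : HS_lt l k -> forall h, (k <= h)%N ->
    rspine (ooplus r (Node l r)) h = h.
  move=> lt_l h kh; rewrite rspine_ooplus.
  by rewrite [rspine _ _]/= -/(orspine r h) rk// (merge_above_lt lt_l)// rk.
rewrite oplusE; case: o ab => [[]|] /andP[al ar].
(* Open block of ones: both children of the root now have HS number [k], so the block closes and the
   number becomes [k.+1]. *)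
- split=> [|h /= kh|h /= kh|/=].
  + by rewrite HS_Node_r HSr merge_above_is.
  + by apply: lk; lia.
  + rewrite rspine_ooplus [rspine _ _]/= -/(orspine r h).
    rewrite rk ?(merge_above_lt (HS_is_lt al))// ?rk//; lia.
  + by rewrite HS_is_lt//= HSr.
- split; [by rewrite HS_Node_r HSr (merge_above_lt al) | | |] => //=.
  + exact: spineK.
  + by rewrite al HSr eqxx.
- split; [by rewrite HS_Node_r HSr (merge_above_lt al) | | |] => //=.
  + exact: spineK.
  + by rewrite al HSr eqxx.
Qed.

Lemma block_invariant_ominus (a : nat * option bool) (t : btree) :
  block_invariant a t -> block_invariant (block_step a true) (ominus t t).
Proof.
case: t a => l r [k o] [HSt lk rk ab]; rewrite /= in lk rk ab.
have {}HSt : HS (Node l r) = k := HSt.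
have HSl : HS (oominus l (Node l r)) = k by rewrite HS_oominus HSt lk.
have spineK : HS_lt r k -> forall h, (k <= h)%N ->
    lspine (oominus l (Node l r)) h = h.
  move=> lt_r h kh; rewrite lspine_oominus.
  by rewrite [lspine _ _]/= -/(olspine l h) lk// (merge_above_lt lt_r)// lk.
rewrite ominusE; case: o ab => [[]|] /andP[al ar].
- split; [by rewrite HS_Node_l HSl (merge_above_lt ar) | | |] => //=.
  + exact: spineK.
  + by rewrite ar HSl eqxx.
- split=> [|h /= kh|h /= kh|/=].
  + by rewrite HS_Node_l HSl merge_above_is.
  + rewrite lspine_oominus [lspine _ _]/= -/(olspine l h).
    rewrite lk ?(merge_above_lt (HS_is_lt ar))// ?lk//; lia.
  + by apply: rk; lia.
  + by rewrite HSl ltnSn HS_is_lt.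
- split; [by rewrite HS_Node_l HSl (merge_above_lt ar) | | |] => //=.
  + exact: spineK.
  + by rewrite ar HSl eqxx.
Qed.

Lemma blocks_rcons (s : seq bool) (b : bool) :
  blocks (rcons s b) = block_step (blocks s) b.
Proof. by rewrite /blocks foldl_rcons. Qed.

Lemma block_invariant_butterfly (s : seq bool) :
  block_invariant (blocks s) (butterfly s).
Proof.
elim/last_ind: s => [|s b IHs]; first by split.
rewrite blocks_rcons /butterfly foldl_rcons -/(butterfly s).
by case: b; [exact: block_invariant_ominus | exact: block_invariant_oplus].
Qed.

Lemma HS_butterfly (s : seq bool) : HS (butterfly s) = (blocks s).1.
Proof.
by have := block_invariant_butterfly s; case: (butterfly s) => l r [].
Qed.

(** * The martingale and its bounded increments *)

Local Open Scope classical_set_scope.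
Local Open Scope ring_scope.

Definition rate (R : realFieldType) (p : R) : R := p * (1 - p) / (1 - p * (1 - p)).

(* The solution, vanishing at None, of the Poisson equation that makes excess
   below a martingale when the bits are i.i.d. Bernoulli(p). *)
Definition potential (R : realFieldType) (p : R) (o : option bool) : R :=
  match o with
  | None => 0
  | Some false => p ^+ 2 / (1 - p * (1 - p))
  | Some true => (1 - p) ^+ 2 / (1 - p * (1 - p))
  end.

Definition excess (R : realFieldType) (p : R) (s : seq bool) : R :=
  (blocks s).1%:R + potential p (blocks s).2 - rate p * (size s)%:R.

Lemma rate_denom_gt0 (R : realFieldType) (p : R) : 0 < 1 - p * (1 - p).
Proof. by have := sqr_ge0 (p - 2^-1); rewrite expr2; lra. Qed.

Lemma rate01 (R : realFieldType) (p : R) : 0 <= p <= 1 -> 0 <= rate p <= 1.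
Proof.
move=> p01; have D := rate_denom_gt0 p.
rewrite /rate ler_pdivrMr// ler_pdivlMr// mul0r mul1r.
by have := sqr_ge0 (p - 2^-1); rewrite expr2; nra.
Qed.

Lemma potential01 (R : realFieldType) (p : R) (o : option bool) :
  0 <= p <= 1 -> 0 <= potential p o <= 1.
Proof.
move=> p01; have D := rate_denom_gt0 p; case: o => [[]|] /=; last by lra.
- by rewrite ler_pdivrMr// ler_pdivlMr// mul0r mul1r expr2; nra.
- by rewrite ler_pdivrMr// ler_pdivlMr// mul0r mul1r expr2; nra.
Qed.

(** The zero mean is the Poisson equation, checked in each of the three states. For the bound, an
    increment is a jump of 0 or 1, plus a difference of two potentials in [0,1], minus a rate in
    [0,1]. *)
Lemma excess_step (R : realFieldType) (p : R) (s : seq bool) : 0 <= p <= 1 ->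
  exists d0 d1 : R,
  [/\ excess p (rcons s false) = excess p s + d0,
      excess p (rcons s true) = excess p s + d1,
      (1 - p) * d0 + p * d1 = 0 & `|d0| <= 2 /\ `|d1| <= 2].
Proof.
move=> p01.
pose D c := excess p (rcons s c) - excess p s.
exists (D false), (D true).
split; [by rewrite addrC subrK|by rewrite addrC subrK| |].
- have D0 : 1 - p * (1 - p) != 0 by rewrite gt_eqF// rate_denom_gt0.
  rewrite /D /excess !blocks_rcons !size_rcons /rate.
  case: (blocks s) => k [[]|] /=;
    rewrite -?[k.+1%:R]natr1 -![(size s).+1%:R]natr1; by field.
- have r01 := rate01 p01.
  have DE c : D c = (block_step (blocks s) c).1%:R - (blocks s).1%:R +
      potential p (block_step (blocks s) c).2 - potential p (blocks s).2 - rate p.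
    by rewrite /D /excess blocks_rcons size_rcons -[(size s).+1%:R]natr1; ring.
  (* Only the bounds on the potential matter from here, so its formula is forgotten and the goal
     becomes linear. *)
  rewrite !DE; move: (potential p) (fun o => potential01 o p01) => phi phi01.
  have f0 := phi01 (Some false); have f1 := phi01 (Some true).
  have fN := phi01 None.
  rewrite !ler_norml; case: (blocks s) => k [[]|] /=; rewrite -?[k.+1%:R]natr1; lra.
Qed.

(** * One-step moment bounds *)

Lemma second_moment_step (R : realFieldType) (p m d0 d1 : R) : 0 <= p <= 1 ->
  (1 - p) * d0 + p * d1 = 0 -> `|d0| <= 2 -> `|d1| <= 2 ->
  (1 - p) * (m + d0) ^+ 2 + p * (m + d1) ^+ 2 <= m ^+ 2 + 4.
Proof.
move=> /andP[p0 p1] dr /ler_normlP[? ?] /ler_normlP[? ?].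
have h0 : d0 ^+ 2 <= 4 by rewrite expr2; nra.
have h1 : d1 ^+ 2 <= 4 by rewrite expr2; nra.
have -> : (1 - p) * (m + d0) ^+ 2 + p * (m + d1) ^+ 2 =
  m ^+ 2 + 2 * m * ((1 - p) * d0 + p * d1) + ((1 - p) * d0 ^+ 2 + p * d1 ^+ 2).
  by ring.
by rewrite dr; nra.
Qed.

(** The term 4 m^3 d is kept exact because it averages to zero. The rest is at most 8 m^2 d^2 + 3
    d^4, and d^2 <= 4 gives 32 = 8 * 4 and 48 = 3 * 16. *)
Lemma fourth_moment_step (R : realFieldType) (p m d0 d1 : R) : 0 <= p <= 1 ->
  (1 - p) * d0 + p * d1 = 0 -> `|d0| <= 2 -> `|d1| <= 2 ->
  (1 - p) * (m + d0) ^+ 4 + p * (m + d1) ^+ 4 <= m ^+ 4 + 32 * m ^+ 2 + 48.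
Proof.
move=> /andP[p0 p1] dr d02 d12.
(* AM-GM: 4 m d^3 <= 2 (m^2 d^2 + d^4) *)
have bnd d : `|d| <= 2 ->
    (m + d) ^+ 4 <= m ^+ 4 + 4 * m ^+ 3 * d + 32 * m ^+ 2 + 48.
  move=> /ler_normlP[? ?]; have h : d ^+ 2 <= 4 by rewrite expr2; nra.
  have h0 := sqr_ge0 d; have hm := sqr_ge0 m.
  have h2 : d ^+ 2 * d ^+ 2 <= 16 by nra.
  have h3 : 0 <= d ^+ 2 * (m - d) ^+ 2 by rewrite mulr_ge0 ?sqr_ge0.
  have h4 : m ^+ 2 * d ^+ 2 <= 4 * m ^+ 2 by nra.
  have -> : (m + d) ^+ 4 = m ^+ 4 + 4 * m ^+ 3 * d + 8 * (m ^+ 2 * d ^+ 2)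
    + 3 * (d ^+ 2 * d ^+ 2) - 2 * (d ^+ 2 * (m - d) ^+ 2) by ring.
  lra.
have b0 := ler_wpM2l (_ : 0 <= 1 - p) (bnd _ d02).
have b1 := ler_wpM2l p0 (bnd _ d12).
apply: le_trans (lerD (b0 _) b1) _; first by lra.
rewrite le_eqVlt; apply/orP; left; apply/eqP.
transitivity (m ^+ 4 + 32 * m ^+ 2 + 48 + 4 * m ^+ 3 * ((1 - p) * d0 + p * d1)).
  by ring.
by rewrite dr mulr0 addr0.
Qed.

(** * Bernoulli means over bitstrings of fixed length *)

Fixpoint bitseqs (n : nat) : seq (seq bool) :=
  if n is n'.+1 then [seq rcons s b | s <- bitseqs n', b <- [:: false; true]]
  else [:: [::]].

Lemma bitseqs_uniq (n : nat) : uniq (bitseqs n).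
Proof.
elim: n => // n IHn; apply: allpairs_uniq => //.
by move=> [s b] [s' b'] _ _ /= /rcons_inj[-> ->].
Qed.

Lemma mem_bitseqs (n : nat) (s : seq bool) : (s \in bitseqs n) = (size s == n).
Proof.
elim: n s => [|n IHn] s; first by rewrite inE size_eq0.
apply/allpairsP/idP => [[[t b] /= [tn _ ->]]|].
  by rewrite size_rcons eqSS -IHn.
case/lastP: s => // t b; rewrite size_rcons eqSS -IHn => tn.
by exists (t, b); split=> //; case: b; rewrite !inE.
Qed.

Definition bern_weight (R : realFieldType) (p : R) (s : seq bool) : R :=
  \prod_(b <- s) (if b then p else 1 - p).

Definition bern_mean (R : realFieldType) (p : R) (n : nat) (F : seq bool -> R) : R :=
  \sum_(s <- bitseqs n) bern_weight p s * F s.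

Lemma bern_weight_ge0 (R : realFieldType) (p : R) (s : seq bool) :
  0 <= p <= 1 -> 0 <= bern_weight p s.
Proof. by move=> p01; apply: prodr_ge0 => -[] _; lra. Qed.

Lemma bern_mean0 (R : realFieldType) (p : R) (F : seq bool -> R) :
  bern_mean p 0 F = F [::].
Proof. by rewrite /bern_mean big_seq1 /bern_weight big_nil mul1r. Qed.

(** Conditioning on the first [n] bits: the form in which the one-step bounds are iterated. *)
Lemma bern_meanS (R : realFieldType) (p : R) (n : nat) (F : seq bool -> R) :
  bern_mean p n.+1 F =
  bern_mean p n (fun s => (1 - p) * F (rcons s false) + p * F (rcons s true)).
Proof.
rewrite /bern_mean big_allpairs_dep; apply: eq_bigr => s _.
rewrite big_cons big_seq1 /bern_weight -!cats1 !big_cat !big_seq1 /=; ring.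
Qed.

Lemma ler_bern_mean (R : realFieldType) (p : R) (n : nat) (F G : seq bool -> R) :
  0 <= p <= 1 -> (forall s, F s <= G s) -> bern_mean p n F <= bern_mean p n G.
Proof.
move=> p01 FG; apply: ler_sum => s _.
by apply: ler_wpM2l (FG s); exact: bern_weight_ge0.
Qed.

Lemma bern_meanD (R : realFieldType) (p : R) (n : nat) (F G : seq bool -> R) :
  bern_mean p n (fun s => F s + G s) = bern_mean p n F + bern_mean p n G.
Proof. by rewrite -big_split; apply: eq_bigr => s _; rewrite mulrDr. Qed.

Lemma bern_meanZ (R : realFieldType) (p c : R) (n : nat) (F : seq bool -> R) :
  bern_mean p n (fun s => c * F s) = c * bern_mean p n F.
Proof. by rewrite /bern_mean mulr_sumr; apply: eq_bigr => s _; rewrite mulrCA. Qed.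

Lemma bern_mean_cst (R : realFieldType) (p c : R) (n : nat) :
  bern_mean p n (fun=> c) = c.
Proof.
elim: n => [|n IHn]; first by rewrite bern_mean0.
by rewrite bern_meanS -mulrDl subrK mul1r.
Qed.

Lemma excess_nil (R : realFieldType) (p : R) : excess p [::] = 0.
Proof. by rewrite /excess /= mulr0 subr0 addr0. Qed.

Lemma bern_mean_excess2 (R : realFieldType) (p : R) (n : nat) : 0 <= p <= 1 ->
  bern_mean p n (fun s => excess p s ^+ 2) <= 4 * n%:R.
Proof.
move=> p01; elim: n => [|n IHn].
  by rewrite bern_mean0 excess_nil expr0n mulr0.
rewrite bern_meanS; apply: (@le_trans _ _
    (bern_mean p n (fun s => excess p s ^+ 2 + 4))).
  apply: ler_bern_mean => // s; have [d0 [d1 [-> -> dr [? ?]]]] := excess_step s p01.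
  exact: second_moment_step.
by rewrite bern_meanD bern_mean_cst -[n.+1%:R]natr1; lra.
Qed.

(** By the second moment bound each step adds at most 32 * 4n + 48, which is below 64 (n+1)^2 - 64
    n^2 = 128 n + 64. *)
Lemma bern_mean_excess4 (R : realFieldType) (p : R) (n : nat) : 0 <= p <= 1 ->
  bern_mean p n (fun s => excess p s ^+ 4) <= 64 * n%:R ^+ 2.
Proof.
move=> p01; elim: n => [|n IHn].
  by rewrite bern_mean0 excess_nil !expr0n mulr0.
rewrite bern_meanS; apply: (@le_trans _ _
    (bern_mean p n (fun s => excess p s ^+ 4 + 32 * excess p s ^+ 2 + 48))).
  apply: ler_bern_mean => // s; have [d0 [d1 [-> -> dr [? ?]]]] := excess_step s p01.
  exact: fourth_moment_step.
rewrite !bern_meanD bern_meanZ bern_mean_cst -[n.+1%:R]natr1.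
have := bern_mean_excess2 n p01; have n0 : 0 <= n%:R :> R by [].
by rewrite sqrrD expr1n mulr1; lra.
Qed.

(** * From the probability space to finite sums *)

Lemma iid_bernoulli_prefix d (T : measurableType d) (R : realType)
    (P : probability T R) (p : R) (x : nat -> {RV P >-> bool}) (n : nat)
    (s : seq bool) : 0 <= p <= 1 -> iid_bernoulli p x -> size s = n ->
  measurable [set w | mkseq (fun j => x j w) n = s] /\
  P [set w | mkseq (fun j => x j w) n = s] = (bern_weight p s)%:E.
Proof.
move=> p01 [indep law] sn.
pose J := [fset j in iota 0 n]%fset.
have JP j : (j \in J) = (j < n)%N by rewrite !inE mem_iota.
have -> : [set w | mkseq (fun j => x j w) n = s] =
    \bigcap_(j in [set` J]) x j @^-1` [set nth false s j].
  apply/seteqP; split=> w /=.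
    by move=> <- j /=; rewrite JP => jn; rewrite /= nth_mkseq.
  move=> H; apply: (@eq_from_nth _ false); rewrite size_mkseq ?sn// => j jn.
  by rewrite nth_mkseq//; apply: H; rewrite /= JP.
split.
  apply: fin_bigcap_measurable; first exact: finite_fset.
  by move=> j _; exact: measurable_funPTI.
rewrite indep//; transitivity (\prod_(j <- iota 0 n)
    (if nth false s j then p else 1 - p)%:E)%E.
  rewrite (perm_big (iota 0 n)); last first.
    by apply: uniq_perm; rewrite ?fset_uniq ?iota_uniq// => j; rewrite JP mem_iota.
  apply: eq_bigr => j _; have := law j [set nth false s j].
  rewrite /distribution/= /pushforward => ->.
  by rewrite bernoulli_probE//; case: nth;
    rewrite !diracE !classical_sets.in_set1/= !(mule1, mule0, adde0, add0e).
by rewrite prodEFin /bern_weight (big_nth false) sn /index_iota subn0.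
Qed.

(** The prefix takes finitely many values, so the integrand is a finite combination of indicators of
    prefix events, whatever [F] is. *)
Lemma integral_iid_bernoulli_prefix d (T : measurableType d) (R : realType)
    (P : probability T R) (p : R) (x : nat -> {RV P >-> bool}) (n : nat)
    (F : seq bool -> R) : 0 <= p <= 1 -> iid_bernoulli p x ->
  (forall s, 0 <= F s) ->
  measurable_fun setT (fun w => F (mkseq (fun j => x j w) n)) /\
  (\int[P]_w (F (mkseq (fun j => x j w) n))%:E = (bern_mean p n F)%:E)%E.
Proof.
move=> p01 iid F0.
pose A s := [set w | mkseq (fun j => x j w) n = s].
have mA s : measurable (A s).
  have [sn|sn] := eqVneq (size s) n.
    by have [] := iid_bernoulli_prefix p01 iid sn.
  rewrite (_ : A s = set0)//; apply/seteqP; split=> // w /= ws.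
  by move: sn; rewrite -ws size_mkseq eqxx.
pose f s := F s \*o (\1_(A s) : T -> R).
have FE : (fun w => (F (mkseq (fun j => x j w) n))%:E) =
    (fun w => \sum_(s <- bitseqs n) (f s w)%:E)%E.
  apply/funext => w; set t := mkseq _ _.
  have tn : t \in bitseqs n by rewrite mem_bitseqs size_mkseq.
  rewrite (bigD1_seq t) ?bitseqs_uniq//= /f/= indicE mem_set// mulr1.
  rewrite big1 ?adde0// => s st; rewrite indicE memNset ?mulr0// => /esym/eqP.
  by rewrite (negbTE st).
have mf s : measurable_fun setT (EFin \o f s : T -> \bar R).
  by apply/measurable_EFinP/measurable_funM => //; exact: measurable_indic.
have f0 s w : (0 <= (f s w)%:E)%E by rewrite lee_fin mulr_ge0.
rewrite -measurable_EFinP [X in measurable_fun _ X]FE FE.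
split; first exact: emeasurable_sum.
rewrite ge0_integral_sum// /bern_mean -sumEFin; apply: eq_big_seq => s.
rewrite mem_bitseqs => /eqP sn.
under eq_integral do rewrite /f/= EFinM.
rewrite ge0_integralZl//; last 2 first.
- by apply/measurable_EFinP; exact: measurable_indic.
- by rewrite lee_fin.
rewrite integral_indic// setIT [RHS]EFinM [RHS]muleC; congr (_ * _)%E.
by have [] := iid_bernoulli_prefix p01 iid sn.
Qed.

(** * Almost sure convergence *)

(** By Tonelli the sum of the series is integrable, hence finite almost everywhere, and the terms of
    a convergent series tend to 0. *)
Lemma ae_cvg0_summable d (T : measurableType d) (R : realType)
    (mu : {measure set T -> \bar R}) (f : nat -> T -> R) :
  (forall n, measurable_fun setT (f n)) -> (forall n w, 0 <= f n w) ->
  (\sum_(n <oo) \int[mu]_w (f n w)%:E < +oo)%E ->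
  {ae mu, forall w, f n w @[n --> \oo] --> 0}.
Proof.
move=> mf f0 foo.
have int_sum : mu.-integrable setT (fun w => (\sum_(n <oo) (f n w)%:E)%E).
  apply/integrableP; split.
    apply: ge0_emeasurable_sum => [k w _ _|k _]; first by rewrite lee_fin f0.
    exact/measurable_EFinP.
  under eq_integral => w _.
    rewrite gee0_abs; last by apply: nneseries_ge0 => n _ _; rewrite lee_fin.
    over.
  rewrite integral_nneseries// => n; first exact/measurable_EFinP.
  by move=> w _; rewrite lee_fin.
apply: filterS (integrable_ae measurableT int_sum) => w /(_ I) Sfin.
apply: cvg_series_cvg_0; apply: nondecreasing_is_cvgn.
  by apply: nondecreasing_series => n _ _; exact: f0.
exists (fine (\sum_(n <oo) (f n w)%:E)%E) => _ [n _ <-].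
rewrite -lee_fin fineK// /series /= -sumEFin.
by apply: nneseries_lim_ge => k _ _; rewrite lee_fin.
Qed.

Lemma sum_inv_sqr_le (R : realFieldType) (n : nat) :
  \sum_(0 <= k < n) (k%:R ^- 2 : R) <= 2.
Proof.
(* This sharper bound makes the induction close by near-telescoping. The term [k = 0] is 0, since
   the inverse of 0 is 0. *)
suff H : \sum_(0 <= k < n.+1) (k%:R ^- 2 : R) <= 2 - 2 / n.+1%:R.
  rewrite big_nat_recr//= in H.
  apply: le_trans (le_trans _ H) _.
    by rewrite lerDl invr_ge0 sqr_ge0.
  by rewrite gerBl.
elim: n => [|n IHn]; first by rewrite big_nat1 expr0n invr0 divr1 subrr.
rewrite big_nat_recr//=; apply: le_trans (lerD IHn (lexx _)) _.
rewrite -[n.+2%:R]natr1; have : 1 <= n.+1%:R :> R by rewrite ler1n.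
move: n.+1%:R => y y1; rewrite -subr_ge0.
have -> : 2 - 2 / (y + 1) - (2 - 2 / y + y ^- 2) = (y - 1) / (y ^+ 2 * (y + 1)).
  by field; apply/andP; split; lra.
by apply: divr_ge0; [lra | apply: mulr_ge0; [exact: sqr_ge0 | lra]].
Qed.

Lemma cvg0_expr4 (R : realType) (u : nat -> R) :
  u n ^+ 4 @[n --> \oo] --> 0 -> u n @[n --> \oo] --> 0.
Proof.
move=> u4; apply/cvgr0Pnorm_lt => e e0.
have /cvgr0Pnorm_lt/(_ _ (exprn_gt0 4 e0)) := u4; apply: filterS => n.
by rewrite normrX ltr_pXn2r ?nnegrE// ltW.
Qed.

Lemma ae_excess_cvg0 d (T : measurableType d) (R : realType)
    (P : probability T R) (p : R) (x : nat -> {RV P >-> bool}) :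
  0 <= p <= 1 -> iid_bernoulli p x ->
  {ae P, forall w, n%:R^-1 * excess p (mkseq (fun j => x j w) n)
                     @[n --> \oo] --> 0}.
Proof.
move=> p01 iid.
(* With squares the bound 4n on the second moment would only give a divergent harmonic series;
   fourth powers give 64 / n^2. *)
pose F n s := (n%:R^-1 * excess p s) ^+ 4.
have F0 n s : 0 <= F n s by rewrite /F (exprM _ 2 2) sqr_ge0.
suff : {ae P, forall w, F n (mkseq (fun j => x j w) n) @[n --> \oo] --> 0}.
  by apply: filterS => w; exact: cvg0_expr4.
apply: ae_cvg0_summable => [n|n w|]; last 2 first.
- exact: F0.
(* 128 = 64 * 2: the fourth moment constant times the bound on the sum of inverse squares. *)
- apply: (@le_lt_trans _ _ 128%:E); last exact: ltry.
  apply: lime_le.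
    by apply: is_cvg_nneseries => n _ _; apply: integral_ge0 => w _; rewrite lee_fin.
  apply: nearW => n.
  apply: (@le_trans _ _ (\sum_(0 <= k < n) (64 * k%:R ^- 2)%:E)%E).
    apply: lee_sum => k _.
    have [_ ->] := integral_iid_bernoulli_prefix k p01 iid (F0 k).
    have -> : bern_mean p k (F k) =
        k%:R^-1 ^+ 4 * bern_mean p k (fun s => excess p s ^+ 4).
      by rewrite -bern_meanZ; apply: eq_bigr => s _; rewrite /F exprMn.
    rewrite lee_fin; apply: (@le_trans _ _ (k%:R^-1 ^+ 4 * (64 * k%:R ^+ 2))).
      by rewrite ler_wpM2l ?exprn_ge0// bern_mean_excess4.
    have [->|k0] := eqVneq k 0; first by rewrite !expr0n !mulr0 invr0 mulr0.
    have k0' : k%:R != 0 :> R by rewrite pnatr_eq0.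
    by rewrite le_eqVlt; apply/orP; left; apply/eqP; by field.
  rewrite sumEFin lee_fin -mulr_sumr; have := sum_inv_sqr_le R n; lra.
- by have [] := integral_iid_bernoulli_prefix n p01 iid (F0 n).
Qed.

Theorem theorem3 (R : realType) (d : measure_display) (T : measurableType d)
  (P : probability T R) (p q : R) (x : nat -> {RV P >-> bool})
  (p01 : 0 <= p <= 1) (qE : q = 1 - p) (x_iid : iid_bernoulli p x) :
  {ae P, forall w : T,
    (fun n : nat =>
       n%:R^-1 * (HS (butterfly (mkseq (fun j => x j w) n)))%:R : R)
      @ \oo --> p * q / (1 - p * q)}.
Proof.
apply: filterS (ae_excess_cvg0 p01 x_iid) => w exc0.
rewrite qE -/(rate p).
pose X n := mkseq (fun j => x j w) n.
have inv0 : (n%:R^-1 : R) @[n --> \oo] --> 0.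
  apply/gtr0_cvgV0; last exact: cvgr_idn.
  by exists 1%N => // n /= n0; rewrite ltr0n.
have pot0 : n%:R^-1 * potential p (blocks (X n)).2 @[n --> \oo] --> 0.
  apply: squeeze_cvgr (cvg_cst 0) inv0; apply: nearW => n.
  have /andP[h0 h1] := potential01 (blocks (X n)).2 p01.
  by rewrite mulr_ge0//= ler_piMr.
(* For n >= 1 this expression equals the HS number divided by n, by the definition of [excess]; at n
   = 0 the rate term would not cancel, hence the eventual equality below. *)
have lim : n%:R^-1 * excess p (X n) - n%:R^-1 * potential p (blocks (X n)).2
    + rate p @[n --> \oo] --> 0 - 0 + rate p.
  by apply: cvgD (cvg_cst _); exact: cvgB exc0 pot0.
rewrite subr0 add0r in lim; refine (cvg_trans (near_eq_cvg _) lim).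
exists 1%N => // n /= n0; have n0' : n%:R != 0 :> R by rewrite pnatr_eq0 -lt0n.
rewrite HS_butterfly -/(X n) /excess size_mkseq; by field.
Qed.
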